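(* There exist universal constants $c_\lambda,c_{\lambda_0},C>0$ such that the following holds. In the setting described in the context with $N=0$ (all predictors categorical), let $p_{\max}=\max_{j\in[q]}p_j$ and let $\lambda,\lambda_0\ge0$ satisfy at least one of $\lambda\ge c_\lambda\sigma^2p_{\max}\log(eq)/n$ and $\lambda_0\ge c_{\lambda_0}\sigma^2\log(ep)/n$. Let $(\hat\alpha,\hat{\boldsymbol\beta})$ be a global minimiser of $$\frac1n\|\boldsymbol y-\alpha\mathbf 1-\boldsymbol X\boldsymbol\beta\|_2^2+\lambda_0\|\boldsymbol\beta\|_0+\lambda\sum_{j=1}^q\big|\{\beta_k:k\in\mathcal I_j\}\big|$$ over $\alpha\in\mathbb R,\boldsymbol\beta\in\mathbb R^p$. Then, with probability at least $1-8(ep)^{-9}-8(eq)^{-9p_{\max}}$, $$\frac1n\|\mathbf f^*-\boldsymbol X\hat{\boldsymbol\beta}-\hat\alpha\mathbf 1\|_2^2\le C\inf_{\boldsymbol\beta\in\mathbb R^p,\alpha\in\mathbb R}\Big\{\frac1n\|\mathbf f^*-\boldsymbol X\boldsymbol\beta-\alpha\mathbf 1\|_2^2+\lambda_0(\|\boldsymbol\beta\|_0\vee1)+\lambda(K(\boldsymbol\beta)\vee1)\Big\}.$$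
   Context: Setting: $q\ge1$ categorical predictors, the $j$-th taking values in $[p_j]$, and no continuous predictors, so $p=\sum_{j=1}^qp_j$. There are $n$ observations; observation $i$ has values $C^{(i)}_j\in[p_j]$. The design matrix $\boldsymbol X\in\mathbb R^{n\times p}$ has $i$-th row $(\mathbf 1(C^{(i)}_1=1),\dots,\mathbf 1(C^{(i)}_1=p_1),\dots,\mathbf 1(C^{(i)}_q=1),\dots,\mathbf 1(C^{(i)}_q=p_q))$ with $\mathbf 1(\cdot)$ the indicator; $\mathcal I_1=\{1,\dots,p_1\}$, $\mathcal I_2=\{p_1+1,\dots,p_1+p_2\}$, etc. The data are $\boldsymbol y=\mathbf f^*+\boldsymbol\epsilon$ with $\mathbf f^*\in\mathbb R^n$ and $\boldsymbol X$ deterministic and $\boldsymbol\epsilon\sim\mathcal N(\mathbf 0,\sigma^2\boldsymbol I_n)$. $\mathbf 1$ is also the all-ones vector in $\mathbb R^n$. $K(\boldsymbol\beta)=\sum_{j=1}^q|\{\beta_i:i\in\mathcal I_j,\beta_i\ne0\}|$. $a\vee b=\max(a,b)$. Universal constants do not depend on $n,p,q,\sigma,\mathbf f^*,\boldsymbol X,\lambda,\lambda_0$. *)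

(* Defs.v *)
From HB Require Import structures.
From mathcomp Require Import all_boot all_order all_algebra.
From mathcomp Require Import all_classical all_reals all_analysis.
Set Implicit Arguments. Unset Strict Implicit. Unset Printing Implicit Defensive.
Import Order.TTheory GRing.Theory Num.Theory.
Local Open Scope classical_set_scope.
Local Open Scope ring_scope.

Section Model.
Variables (R : realType) (n q : nat) (p : 'I_q -> nat).

(* Column index set of the design matrix: pairs (j, k) with j in [q], k in [p_j];
   it has p = \sum_j p_j elements (the concatenation I_1, ..., I_q). *)
Definition colidx := {j : 'I_q & 'I_(p j)}.

Definition ptot : nat := (\sum_(j < q) p j)%N.
Definition pmax : nat := (\max_(j < q) p j)%N.

Variable Cat : 'I_n -> forall j : 'I_q, 'I_(p j).

Definition Xdes (i : 'I_n) (c : colidx) : R :=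
  if Cat i (tag c) == tagged c then 1 else 0.

Definition Xmul (beta : colidx -> R) (i : 'I_n) : R :=
  \sum_(c : colidx) Xdes i c * beta c.

Definition sqnorm (v : 'I_n -> R) : R := \sum_(i < n) v i ^+ 2.

Definition l0 (beta : colidx -> R) : nat := #|[set c | beta c != 0]|.

Definition grpvals (beta : colidx -> R) (j : 'I_q) : seq R :=
  [seq beta (Tagged (fun j => 'I_(p j)) k) | k <- enum 'I_(p j)].

Definition ndistinct (beta : colidx -> R) (j : 'I_q) : nat :=
  size (undup (grpvals beta j)).

Definition Kcount (beta : colidx -> R) : nat :=
  (\sum_(j < q) size (undup [seq x <- grpvals beta j | x != 0%R]))%N.

Definition objective (lam lam0 : R) (y : 'I_n -> R) (alpha : R) (beta : colidx -> R) : R :=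
  n%:R^-1 * sqnorm (fun i => y i - alpha - Xmul beta i)
  + lam0 * (l0 beta)%:R
  + lam * (\sum_(j < q) ndistinct beta j)%:R.

Definition is_global_minimiser (lam lam0 : R) (y : 'I_n -> R) (ah : R) (bh : colidx -> R) :=
  forall (alpha : R) (beta : colidx -> R),
    objective lam lam0 y ah bh <= objective lam lam0 y alpha beta.

Definition oracle (lam lam0 : R) (f : 'I_n -> R) (alpha : R) (beta : colidx -> R) : R :=
  n%:R^-1 * sqnorm (fun i => f i - Xmul beta i - alpha)
  + lam0 * (maxn (l0 beta) 1)%:R
  + lam * (maxn (Kcount beta) 1)%:R.

End Model.

(* eps = (eps_1,...,eps_n) ~ N(0, sigma^2 I_n): measurable, each coordinate
   N(0, sigma^2) (normal_prob takes the standard deviation), mutually independent. *)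
Definition gaussian_noise (R : realType) (d : measure_display) (T : measurableType d)
    (P : probability T R) (n : nat) (eps : 'I_n -> T -> R) (sigma : R) : Prop :=
  [/\ forall i, measurable_fun setT (eps i),
      forall i (B : set R), measurable B ->
        P (eps i @^-1` B) = normal_prob 0 sigma B
    & forall B : 'I_n -> set R, (forall i, measurable (B i)) ->
        P (\bigcap_(i in setT) (eps i @^-1` B i)) =
        (\prod_(i < n) P (eps i @^-1` B i))%E ].

(* Main.v *)
Require Import Defs.
From HB Require Import structures.
From mathcomp Require Import all_boot all_order all_algebra.
From mathcomp Require Import all_classical all_reals all_analysis.
From mathcomp Require Import measurable_realfun ring lra.
Import Order.TTheory GRing.Theory Num.Theory.
Local Open Scope classical_set_scope.
Local Open Scope ring_scope.

(* If a model A (a set of groups of columns) spans a space of dimension k, the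
   squared norm of the projection of the noise on it has an exponential moment
   bounded by c^k, and a union bound over all the models A gives one event on which
   this norm is at most of order sigma^2 M (|A| v 1) log(em), where m is the number
   of groups and M bounds their sizes. The fit of the minimiser minus the fit of any
   competitor lies in the model A made of the groups active in one of the two, so on
   this event the noise term of the basic inequality is absorbed by the penalties.
   If lambda is large the groups are the predictors (m = q, M = pmax), and a
   predictor is active when its coefficients are not all equal: otherwise it only
   contributes a constant, because each observation has exactly one level per
   predictor. If lambda_0 is large the groups are the single columns (m = p,
   M = 1), active when the coefficient is nonzero. *)

(** * Integration against weighted image measures, and products of independent variables *)

Section WeightedPushforward.
Import HBNNSimple.
Context d1 d2 (T1 : measurableType d1) (T2 : measurableType d2) (R : realType).
Variables (P : {measure set T1 -> \bar R}) (mu : {measure set T2 -> \bar R}).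
Local Open Scope ereal_scope.

(** The identity assumed for indicators passes to simple functions by linearity and to [f] by
    monotone convergence. It serves twice: with [X] the identity and [G] a density, and with [G] the
    product of the remaining factors in an independence argument. *)
Lemma ge0_integral_weighted_pushforward (X : T1 -> T2) (G : T1 -> R) (c : \bar R)
    (f : T2 -> R) :
  measurable_fun setT X -> measurable_fun setT G -> (forall w, 0 <= G w)%R ->
  0 <= c -> c \is a fin_num ->
  (forall B, measurable B -> \int[P]_w (\1_B (X w) * G w)%:E = c * mu B) ->
  measurable_fun setT f -> (forall x, 0 <= f x)%R ->
  \int[P]_w (f (X w) * G w)%:E = c * \int[mu]_x (f x)%:E.
Proof.
move=> mX mG G0 c0 cfin PG mf f0.
have mEf : measurable_fun setT (fun x => (f x)%:E) by apply/measurable_EFinP.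
pose h := nnsfun_approx measurableT mEf.
have hf x : (fun n => (h n x)%:E) @ \oo --> (f x)%:E.
  by apply: (cvg_nnsfun_approx measurableT mEf) => // y _; rewrite lee_fin.
have mh n : measurable_fun setT (h n) by exact: measurable_funP.
have hnd x a b : (a <= b)%N -> (h a x <= h b x)%R.
  by move=> ab; exact/lefP/nd_nnsfun_approx.
have -> : \int[mu]_x (f x)%:E = lim (\int[mu]_x (h n x)%:E @[n --> \oo]).
  rewrite -monotone_convergence//.
  - by apply: eq_integral => x _; apply/esym/cvg_lim => //; exact: hf.
  - by move=> n; exact/measurable_EFinP.
  - by move=> n x _; rewrite lee_fin.
  - by move=> x _ a b ab; rewrite lee_fin hnd.
have mhX n : measurable_fun setT (fun w => (h n (X w) * G w)%R).
  by apply: measurable_funM => //; exact: measurableT_comp (mh n) mX.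
have -> : \int[P]_w (f (X w) * G w)%:E
    = lim (\int[P]_w (h n (X w) * G w)%:E @[n --> \oo]).
  rewrite -monotone_convergence//.
  - apply: eq_integral => w _; apply/esym/cvg_lim => //.
    under eq_fun do rewrite EFinM.
    by rewrite EFinM; apply: cvgeZr => //; exact: hf.
  - by move=> n; exact/measurable_EFinP.
  - by move=> n w _; rewrite lee_fin mulr_ge0.
  - by move=> w _ a b ab; rewrite lee_fin ler_wpM2r ?hnd.
rewrite -limeMl//; last first.
  apply: ereal_nondecreasing_is_cvgn => a b ab; apply: ge0_le_integral => //.
  - by move=> x _; rewrite lee_fin.
  - exact/measurable_EFinP.
  - exact/measurable_EFinP.
  - by move=> x _; rewrite lee_fin hnd.
suff -> : (fun n => \int[P]_w (h n (X w) * G w)%:E) =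
          (fun n => c * \int[mu]_x (h n x)%:E) by [].
apply/funext => n.
have mpre r : measurable (h n @^-1` [set r]) by exact: measurable_sfunP.
have -> : \int[mu]_x (h n x)%:E = \sum_(r \in range (h n)) r%:E * mu (h n @^-1` [set r]).
  by rewrite integral_nnsfun// patch_setT sintegralE.
have hE x : (h n x = \sum_(r \in range (h n)) r * \1_(h n @^-1` [set r]) x)%R.
  by rewrite {1}(fimfunE (h n) x).
transitivity (\int[P]_w (\sum_(r \in range (h n))
   (r * (\1_(h n @^-1` [set r]) (X w) * G w))%:E)).
  apply: eq_integral => w _; rewrite fsumEFin// hE; congr EFin.
  rewrite mulr_fsuml//.
  by apply: eq_fsbigr => r _; rewrite mulrA.
have m1 r : measurable_fun setT (fun w => \1_(h n @^-1` [set r]) (X w) * G w)%R.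
  apply: measurable_funM => //.
  by apply: measurableT_comp mX; exact: measurable_indic.
rewrite ge0_integral_fsum//; last 2 first.
- by move=> r; apply/measurable_EFinP/measurable_funM => //.
- move=> r w _; rewrite lee_fin.
  have [r0|r0] := leP 0%R r; first by rewrite !mulr_ge0.
  by rewrite preimage_nnfun0// indic0 /= mul0r mulr0.
rewrite ge0_mule_fsumr; last first.
  move=> r; have [r0|r0] := leP 0%R r; first by rewrite mule_ge0.
  by rewrite preimage_nnfun0// measure0 mule0.
apply: eq_fsbigr => r _.
(* A negative [r] is not a value of the nonnegative [h n], so both sides vanish. *)
have [r0|r0] := leP 0%R r; last first.
  rewrite preimage_nnfun0// measure0 !mule0 integral0_eq// => w _.
  by rewrite indic0 mul0r mulr0.
under eq_integral do rewrite EFinM.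
rewrite ge0_integralZl//; first by rewrite PG// muleCA.
- exact/measurable_EFinP.
- by move=> w _; rewrite lee_fin mulr_ge0.
Qed.
End WeightedPushforward.

Section Independence.
Context d1 d2 (T1 : measurableType d1) (T2 : measurableType d2) (R : realType).
Variables (P : probability T1 R) (mu : probability T2 R).
Local Open Scope ereal_scope.

(** Induction on the number [k] of leading factors that may be arbitrary, those of index at least
    [k] being indicators. For [k = 0] this is independence of events; the induction step frees one
    more factor, with the product of all the others as weight. *)
Lemma integral_prod_iid n (X : 'I_n -> T1 -> T2) (f : 'I_n -> T2 -> R) :
  (forall i, measurable_fun setT (X i)) ->
  (forall i B, measurable B -> P (X i @^-1` B) = mu B) ->
  (forall B : 'I_n -> set T2, (forall i, measurable (B i)) ->
     P (\bigcap_(i in setT) (X i @^-1` B i)) = \prod_(i < n) P (X i @^-1` B i)) ->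
  (forall i, measurable_fun setT (f i)) -> (forall i x, 0 <= f i x)%R ->
  (forall i, \int[mu]_x (f i x)%:E \is a fin_num) ->
  \int[P]_w (\prod_(i < n) f i (X i w))%:E = \prod_(i < n) \int[mu]_x (f i x)%:E.
Proof.
move=> mX lawX indX.
suff H k : forall f : 'I_n -> T2 -> R,
    (forall i, measurable_fun setT (f i)) -> (forall i x, 0 <= f i x)%R ->
    (forall i, \int[mu]_x (f i x)%:E \is a fin_num) ->
    (forall i : 'I_n, (k <= i)%N -> exists2 B, measurable B & f i = \1_B) ->
    \int[P]_w (\prod_(i < n) f i (X i w))%:E = \prod_(i < n) \int[mu]_x (f i x)%:E.
  by move=> mf f0 ffin; apply: (H n) => // i; rewrite leqNgt ltn_ord.
elim: k => [|k IH] {}f mf f0 ffin fB.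
  have /choice[B HB] (i : 'I_n) : exists B, measurable B /\ f i = \1_B.
    by have [B mB fE] := fB i (leq0n _); exists B.
  have mB i : measurable (B i) by have [] := HB i.
  have fE i : f i = \1_(B i) by have [] := HB i.
  have mXB i : measurable (X i @^-1` B i).
    by rewrite -[X in measurable X]setTI; exact: mX.
  transitivity (P (\bigcap_(i in setT) (X i @^-1` B i))).
    have mI : measurable (\bigcap_(i in setT) (X i @^-1` B i)).
      by apply: fin_bigcap_measurable => // i _; exact: mXB.
    transitivity (\int[P]_w (\1_(\bigcap_(i in setT) (X i @^-1` B i)) w)%:E);
      last by rewrite integral_indic// setIT.
    apply: eq_integral => w _; congr EFin.
    rewrite indicE; have [wI|wI] := boolP (w \in _).
      rewrite big1// => i _; rewrite fE indicE mem_set//.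
      by move: wI; rewrite inE => /(_ i); exact.
    have /existsNP[i wi] : ~ forall i, B i (X i w).
      by move=> wB; move: wI; rewrite notin_setE; apply => i _; exact: wB.
    by apply/eqP/prodf_eq0; exists i => //; rewrite fE indicE memNset.
  rewrite indX//; apply: eq_bigr => i _.
  by rewrite lawX// fE integral_indic// setIT.
have [nk|kn] := leqP n k.
  apply: IH => // i ki; exfalso.
  by have := ltn_ord i; rewrite ltnNge (leq_trans nk ki).
pose i0 := Ordinal kn.
pose c := \prod_(i < n | i != i0) \int[mu]_x (f i x)%:E.
have c0 : 0 <= c.
  by apply: prode_ge0 => i _; apply: integral_ge0 => x _; rewrite lee_fin.
rewrite (bigD1 i0)//= -/c muleC.
under eq_integral do rewrite (bigD1 i0)//=.
apply: ge0_integral_weighted_pushforward => //.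
- under eq_fun do rewrite -big_filter.
  by apply: measurable_prod => i _; exact: measurableT_comp (mf i) (mX i).
- by move=> w; apply: prodr_ge0.
- by apply: prode_fin_num => i _; exact: ffin.
move=> B mB.
(* With an indicator at [i0], the factors of index at least [k] are again indicators, so the
   induction hypothesis computes the weighted measure of [B]. *)
pose g i := if i == i0 then \1_B : T2 -> R else f i.
transitivity (\int[P]_w (\prod_(i < n) g i (X i w))%:E).
  apply: eq_integral => w _; rewrite [in RHS](bigD1 i0)//= /g eqxx.
  by congr (_ * _)%:E; apply: eq_bigr => i /negbTE ->.
rewrite IH.
- rewrite (bigD1 i0)//= /g eqxx muleC integral_indic// setIT; congr (_ * _).
  by apply: eq_bigr => i /negbTE ->.
- by move=> i; rewrite /g; case: ifP => // _; exact: measurable_indic.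
- by move=> i x; rewrite /g; case: ifP => // _; rewrite indicE.
- move=> i; rewrite /g; case: ifP => // _.
  by rewrite integral_indic// setIT fin_num_measure.
- move=> i ki; rewrite /g; case: eqP => [_|ne]; first by exists B.
  apply: fB; rewrite ltn_neqAle ki andbT; apply/eqP => kE; apply: ne.
  exact/val_inj.
Qed.
End Independence.

(** * Exponential moments of normal variables and of sums of squares *)

Section Normal.
Context (R : realType).
Implicit Types m s t : R.
Notation leb := (@lebesgue_measure R).

Lemma ge0_integral_normal_prob m s (f : measurableTypeR R -> R) :
  measurable_fun setT f -> (forall x, 0 <= f x) ->
  (\int[normal_prob m s]_x (f x)%:E
   = \int[leb]_x (f x * normal_pdf m s x)%:E)%E.
Proof.
move=> mf f0; rewrite -[LHS]mul1e; apply/esym.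
apply: (@ge0_integral_weighted_pushforward _ _ _ _ _ leb (normal_prob m s) id) => //.
- exact: measurable_normal_pdf.
- exact: normal_pdf_ge0.
move=> B mB; rewrite mul1e /normal_prob [RHS]integral_mkcond; apply: eq_integral => x _.
by rewrite patchE indicE; case: ifP => _; rewrite /= ?mul1r// mul0r.
Qed.

(** Completing the square: the tilted density is a constant times the normal density with mean
    [s ^+ 2 * t]. *)
Lemma normal_mgf s t : s != 0 ->
  (\int[normal_prob 0 s]_x (expR (t * x))%:E = (expR (s ^+ 2 * t ^+ 2 / 2))%:E)%E.
Proof.
move=> s0; rewrite (@ge0_integral_normal_prob 0 s (fun x => expR (t * x))); first last.
- by move=> x; exact: expR_ge0.
- by apply: measurableT_comp => //; exact: measurable_funM.
transitivity (\int[leb]_x ((expR (s ^+ 2 * t ^+ 2 / 2))%:E *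
    (normal_pdf (s ^+ 2 * t) s x)%:E))%E.
  apply: eq_integral => x _; rewrite !normal_pdfE// /normal_fun -EFinM; congr EFin.
  rewrite mulrCA [RHS]mulrCA -!expRD; congr (_ * expR _).
  by rewrite -mulr_natr; field; rewrite s0.
rewrite ge0_integralZl//.
- by rewrite integral_normal_pdf mule1.
- by apply/measurable_EFinP; exact: measurable_normal_pdf.
- by move=> x _; rewrite lee_fin normal_pdf_ge0.
Qed.

(** The standard deviation 3/5 keeps all constants rational: since 25/9 - 1 = 16/9, the integrand is
    a multiple of the normal density with standard deviation 3/4, and the peaks have ratio (3/4) /
    (3/5) = 5/4. *)
Lemma normal_sqr_mgf :
  (\int[normal_prob 0 (3 / 5)]_x (expR (x ^+ 2 / 2))%:E = (5 / 4 : R)%:E)%E.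
Proof.
rewrite (@ge0_integral_normal_prob 0 _ (fun x => expR (x ^+ 2 / 2))); first last.
- by move=> x; exact: expR_ge0.
- by apply: measurableT_comp => //; apply: measurable_funM => //; exact: measurable_funX.
transitivity (\int[leb]_x ((5 / 4)%:E * (normal_pdf 0 (3 / 4) x)%:E))%E.
  have pi0 := pi_gt0 R.
  have peakE (s : R) : 0 < s -> normal_peak s = s^-1 * (Num.sqrt (pi *+ 2))^-1.
    move=> s0; rewrite /normal_peak -mulrnAr sqrtrM ?sqr_ge0// sqrtr_sqr.
    by rewrite gtr0_norm// invfM.
  apply: eq_integral => x _; rewrite !normal_pdfE; [|lra|lra].
  rewrite /normal_fun -EFinM; congr EFin.
  rewrite !peakE; [|lra|lra].
  have sq0 : Num.sqrt (pi *+ 2) != 0 :> R by rewrite gt_eqF// sqrtr_gt0 mulrn_wgt0.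
  rewrite mulrCA -expRD mulrA
    [X in X * expR _ = _](_ : _ = 5 / 4 * ((3 / 4)^-1 * (Num.sqrt (pi *+ 2))^-1)).
    by congr (_ * expR _); field.
  by field; rewrite sq0.
rewrite ge0_integralZl//.
- by rewrite integral_normal_pdf mule1.
- by apply/measurable_EFinP; exact: measurable_normal_pdf.
- by move=> x _; rewrite lee_fin normal_pdf_ge0.
Qed.
End Normal.

(* Induction on [k]: [expR (9 / 50 * z ^+ 2)] is the mean of [expR (z * g)] for g
   normal with standard deviation 3/5, so Tonelli trades one square for a linear
   term with coefficient g, at the price of the mean 5/4 of [expR (g ^+ 2 / 2)]. *)
Lemma integral_expR_sumsq d (T : measurableType d) (R : realType)
    (P : probability T R) k (Y : T -> R) (C : R) (Z : 'I_k -> T -> R) :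
  measurable_fun setT Y -> (forall a, measurable_fun setT (Z a)) -> 0 <= C ->
  (forall h : 'I_k -> R, (\int[P]_w (expR (Y w + \sum_(a < k) h a * Z a w))%:E
     <= (C * expR ((\sum_(a < k) h a ^+ 2) / 2))%:E)%E) ->
  (\int[P]_w (expR (Y w + 9 / 50 * \sum_(a < k) Z a w ^+ 2))%:E
     <= (C * (5 / 4) ^+ k)%:E)%E.
Proof.
elim: k Y C Z => [|k IH] Y C Z mY mZ C0 HZ.
  have := HZ (fun=> 0); rewrite big_ord0 mul0r expR0 expr0.
  move=> H0; apply: (le_trans _ H0); apply: ge0_le_integral => //.
  - apply/measurable_EFinP/measurableT_comp => //; apply: measurable_funD => //.
    apply: measurable_funM => //; apply: measurable_sum => a.
    exact: measurable_funX.
  - apply/measurable_EFinP/measurableT_comp => //; apply: measurable_funD => //.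
    by apply: measurable_sum => a; apply: measurable_funM.
  - by move=> x _; rewrite !big_ord0 mulr0.
pose Z0 := Z ord0; pose Z' a := Z (lift ord0 a).
have mZ0 : measurable_fun setT Z0 by exact: mZ.
have mZ2 : measurable_fun setT (fun w => 9 / 50 * Z0 w ^+ 2).
  by apply: measurable_funM => //; exact: measurable_funX.
have E1 : (\int[P]_w (expR (Y w + 9 / 50 * \sum_(a < k.+1) Z a w ^+ 2))%:E =
  \int[P]_w (expR (Y w + 9 / 50 * Z0 w ^+ 2 + 9 / 50 * \sum_(a < k) Z' a w ^+ 2))%:E)%E.
  by apply: eq_integral => w _; rewrite big_ord_recl mulrDr addrA.
(* The first square is moved into [Y] and a factor 5/4 into [C]; what remains is to check the linear
   hypothesis for this new pair. *)
rewrite E1 exprS mulrA; apply: (IH (fun w => Y w + 9 / 50 * Z0 w ^+ 2)) => //.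
- exact: measurable_funD.
- by move=> a; exact: mZ.
- by rewrite mulr_ge0.
move=> h.
pose S w := Y w + \sum_(a < k) h a * Z' a w.
have mS : measurable_fun setT S.
  apply: measurable_funD => //; apply: measurable_sum => a.
  by apply: measurable_funM => //; exact: mZ.
pose N : probability _ R := normal_prob (0 : R) (3 / 5).
pose F (z : T * measurableTypeR R) := (expR (S z.1 + z.2 * Z0 z.1))%:E.
have mF : measurable_fun setT F.
  apply/measurable_EFinP; apply: measurableT_comp => //; apply: measurable_funD.
    exact: measurableT_comp mS measurable_fst.
  apply: measurable_funM; first exact: measurable_snd.
  exact: measurableT_comp (mZ _) measurable_fst.
have F0 z : (0 <= F z)%E by rewrite lee_fin expR_ge0.
have mexp2 : measurable_fun setT (fun g : measurableTypeR R => expR (g ^+ 2 / 2)).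
  by apply: measurableT_comp => //; apply: measurable_funM => //; exact: measurable_funX.
have -> : (\int[P]_w (expR (Y w + 9 / 50 * Z0 w ^+ 2 + \sum_(a < k) h a * Z' a w))%:E
    = \int[P]_w \int[N]_g F (w, g))%E.
  apply: eq_integral => w _.
  rewrite [RHS](_ : _ = \int[N]_g ((expR (S w))%:E * (expR (Z0 w * g))%:E))%E; last first.
    by apply: eq_integral => g _; rewrite /F /= expRD EFinM (mulrC g).
  rewrite ge0_integralZl//.
  - rewrite normal_mgf; last by lra.
    rewrite -EFinM -expRD /S; congr (expR _)%:E; by field.
  - by apply/measurable_EFinP/measurableT_comp => //; exact: measurable_funM.
rewrite fubini_tonelli//.
apply: (@le_trans _ _ (\int[N]_g ((C * expR ((\sum_(a < k) h a ^+ 2) / 2))%:E *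
   (expR (g ^+ 2 / 2))%:E))%E).
  apply: ge0_le_integral => //.
  - by move=> g _; apply: integral_ge0.
  - exact: measurable_fun_fubini_tonelli_G.
  - apply: emeasurable_funM => //; exact/measurable_EFinP.
  move=> g _.
  (* [h'] extends [h] by the coefficient [g] on the first coordinate, so [HZ] produces the factor
     [expR (g ^+ 2 / 2)]. *)
  pose h' a := if unlift ord0 a is Some b then h b else g.
  have := HZ h'; rewrite big_ord_recl /h' unlift_none mulrDl expRD.
  rewrite [X in C * X]mulrC mulrA EFinM.
  under [X in (expR (X / 2))]eq_bigr do rewrite liftK.
  move=> le1; apply: le_trans le1 => //.
  apply: ge0_le_integral => //.
  - apply: measurableT_comp mF _; exact: measurable_pair2.
  - apply/measurable_EFinP/measurableT_comp => //; apply: measurable_funD => //.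
    by apply: measurable_sum => a; apply: measurable_funM.
  move=> w _; rewrite /F /S /= lee_fin ler_expR big_ord_recl unlift_none.
  under [X in _ <= _ + (_ + X)]eq_bigr do rewrite liftK.
  by rewrite addrAC -addrA.
rewrite ge0_integralZl//.
- by rewrite normal_sqr_mgf -EFinM mulrAC.
- exact/measurable_EFinP.
- by rewrite lee_fin mulr_ge0// expR_ge0.
Qed.

(** * Inner products and orthonormalisation *)

Section Dot.
Context {R : realType} {n : nat}.
Implicit Types x y : 'I_n -> R.

Definition dot x y : R := \sum_(i < n) x i * y i.

Lemma dotC x y : dot x y = dot y x.
Proof. by apply: eq_bigr => i _; rewrite mulrC. Qed.

Lemma dot0r x : dot x (fun=> 0) = 0.
Proof. by apply: big1 => i _; rewrite mulr0. Qed.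

Lemma dotZl (c : R) x y : dot (fun i => c * x i) y = c * dot x y.
Proof. by rewrite /dot mulr_sumr; apply: eq_bigr => i _; rewrite mulrA. Qed.

Lemma dotBl x x' y : dot (fun i => x i - x' i) y = dot x y - dot x' y.
Proof. by rewrite /dot -sumrB; apply: eq_bigr => i _; rewrite mulrBl. Qed.

Lemma dot_suml (J : Type) (s : seq J) (Q : pred J) (c : J -> R) (x : J -> 'I_n -> R) y :
  dot (fun i => \sum_(a <- s | Q a) c a * x a i) y = \sum_(a <- s | Q a) c a * dot (x a) y.
Proof.
rewrite /dot; under eq_bigr do rewrite mulr_suml.
rewrite exchange_big; apply: eq_bigr => a _ /=.
by rewrite mulr_sumr; apply: eq_bigr => i _; rewrite mulrA.
Qed.

Lemma dot_ge0 x : 0 <= dot x x.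
Proof. by apply: sumr_ge0 => i _; rewrite -expr2 sqr_ge0. Qed.

Lemma dot_eq0 x : dot x x = 0 -> x = (fun=> 0).
Proof.
move=> /eqP; rewrite psumr_eq0; last by move=> i _; rewrite -expr2 sqr_ge0.
move=> /allP x0; apply/funext => i; apply/eqP.
by have := x0 i (mem_index_enum i); rewrite /= mulf_eq0 orbb.
Qed.

(* Degenerate directions are kept as zero vectors, so that [size s] bounds the
   dimension without any independence assumption. *)
Lemma gram_schmidt (J : eqType) (v : J -> 'I_n -> R) (s : seq J) :
  exists u : nat -> 'I_n -> R,
  [/\ forall a b, a != b -> dot (u a) (u b) = 0,
      forall a, u a = (fun=> 0) \/ dot (u a) (u a) = 1,
      forall a, (size s <= a)%N -> u a = (fun=> 0) &
      forall c, c \in s -> forall i,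
        v c i = \sum_(a < size s) dot (v c) (u a) * u a i].
Proof.
elim: s => [|c s [u [uo u1 u0 uv]]].
  by exists (fun _ _ => 0); split => //; [move=> *; exact: dot0r | left].
pose k := size s.
pose w i := v c i - \sum_(a < k) dot (v c) (u a) * u a i.
have wu b : dot w (u b) = 0.
  rewrite /w dotBl dot_suml; have [bk|kb] := ltnP b k; last first.
    rewrite u0// !dot0r big1 ?subrr// => a _; by rewrite dot0r mulr0.
  rewrite (bigD1 (Ordinal bk))//= big1 ?addr0 => [|a ab]; last first.
    by rewrite uo ?mulr0//; apply: contraNN ab => /eqP ab; exact/eqP/val_inj.
  by have [->|->] := u1 b; rewrite ?dot0r ?mul0r ?mulr1 subrr.
(* If the residual [w] of [v c] vanishes, [u] is kept: its entry at [k] is already the zero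
   vector. *)
have [w0|w0] := eqVneq (dot w w) 0.
  exists u; split => //; first by move=> a ka; apply: u0; exact: ltnW.
  move=> c'; rewrite inE => /predU1P[->|c's] i /=;
    rewrite big_ord_recr/= -/k (u0 k)// mulr0 addr0.
    by apply/eqP; rewrite -subr_eq0; apply/eqP; have := congr1 (@^~ i) (dot_eq0 _ w0).
  exact: uv.
pose r := (Num.sqrt (dot w w))^-1.
have r2 : r * (r * dot w w) = 1.
  rewrite mulrA -expr2 exprVn sqr_sqrtr ?dot_ge0// mulVf//.
pose uk i := r * w i.
have uku b : dot uk (u b) = 0 by rewrite dotZl wu mulr0.
have ukk : dot uk uk = 1 by rewrite dotZl dotC dotZl.
exists (fun a => if a == k then uk else u a); split.
- move=> a b ab; have [ak|ak] := eqVneq a k; have [bk|bk] := eqVneq b k.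
  + by rewrite ak bk eqxx in ab.
  + exact: uku.
  + by rewrite dotC.
  + exact: uo.
- by move=> a; case: eqP => [_|_]; [right|exact: u1].
- by move=> a ka; rewrite gtn_eqF//; apply: u0; exact: ltnW.
move=> c'; rewrite inE => cs i; rewrite big_ord_recr /= eqxx.
under eq_bigr => a _ do rewrite (ltn_eqF (ltn_ord a)).
move: cs => /predU1P[->|c's].
  have -> : dot (v c) uk = r * dot w w.
    rewrite dotC dotZl; congr (_ * _).
    have vE : v c = fun i => w i - \sum_(a < k) (- dot (v c) (u a)) * u a i.
      apply/funext => j; rewrite /w; under [X in _ - X]eq_bigr do rewrite mulNr.
      by rewrite sumrN opprK subrK.
    rewrite dotC {1}vE dotBl dot_suml [X in _ - X]big1 ?subr0// => a _.
    by rewrite (dotC (u a)) wu mulr0.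
  have -> : r * dot w w * uk i = r * (r * dot w w) * w i by rewrite /uk; ring.
  by rewrite r2 mul1r /w addrC subrK.
rewrite -uv//.
(* Earlier vectors lie in the span of the first [k] directions, to which [uk] is orthogonal. *)
have -> : dot (v c') uk = 0.
  have vE : v c' = fun i => \sum_(a < k) (dot (v c') (u a)) * u a i.
    by apply/funext => j; exact: uv.
  by rewrite vE dot_suml big1// => a _; rewrite (dotC (u a)) uku mulr0.
by rewrite mul0r addr0.
Qed.
End Dot.

(** * Tails of the projected noise *)

Section GaussianNoise.
Context (R : realType) (d : measure_display) (T : measurableType d).
Variables (P : probability T R) (n : nat) (eps : 'I_n -> T -> R) (sigma : R).
Hypotheses (sigma_gt0 : 0 < sigma) (Neps : gaussian_noise P eps sigma).

Lemma measurable_dot_noise (v : 'I_n -> R) :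
  measurable_fun setT (fun w => dot v (eps^~ w)).
Proof.
have [meps _ _] := Neps.
by apply: measurable_sum => i; apply: measurable_funM.
Qed.

Lemma noise_mgf (v : 'I_n -> R) :
  (\int[P]_w (expR (dot v (eps^~ w)))%:E = (expR (sigma ^+ 2 * dot v v / 2))%:E)%E.
Proof.
have [meps law ind] := Neps.
have s0 : sigma != 0 by rewrite gt_eqF.
transitivity (\int[P]_w (\prod_(i < n) expR (v i * eps i w))%:E)%E.
  by apply: eq_integral => w _; rewrite expR_sum.
rewrite (@integral_prod_iid _ _ _ (measurableTypeR R) _ P (normal_prob 0 sigma) n eps
  (fun i x => expR (v i * x))) //.
- under eq_bigr do rewrite normal_mgf//.
  rewrite prodEFin -expR_sum; congr (expR _)%:E.
  rewrite /dot mulr_sumr mulr_suml; apply: eq_bigr => i _.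
  by rewrite expr2.
- by move=> i; apply: measurableT_comp => //; exact: measurable_funM.
- by move=> i; rewrite normal_mgf.
Qed.

(** Chernoff bound with exponent 9/50, through [integral_expR_sumsq] applied to the coordinates of
    the noise divided by [sigma]. Norms at most 1 accommodate the zero vectors left by
    [gram_schmidt]. *)
Lemma noise_projection_tail k (u : nat -> 'I_n -> R) (x : R) :
  (forall a b, a != b -> dot (u a) (u b) = 0) ->
  (forall a, dot (u a) (u a) <= 1) ->
  (P [set w | (x * sigma ^+ 2 < \sum_(a < k) dot (u a) (eps^~ w) ^+ 2)%R]
    <= (expR (- (9 / 50) * x) * (5 / 4) ^+ k)%:E)%E.
Proof.
move=> uo u1.
have s0 : sigma != 0 by rewrite gt_eqF.
pose Z (a : 'I_k) w := sigma^-1 * dot (u a) (eps^~ w).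
have mZ a : measurable_fun setT (Z a).
  by apply: measurable_funM => //; exact: measurable_dot_noise.
pose B := [set w | (x * sigma ^+ 2 < \sum_(a < k) dot (u a) (eps^~ w) ^+ 2)%R].
have mB : measurable B.
  rewrite /B -[X in measurable X]setTI.
  apply: (@measurable_fun_ltr _ _ _ _ (cst _)) => //.
  by apply: measurable_sum => a; apply: measurable_funX; exact: measurable_dot_noise.
apply: le_trans (@integral_expR_sumsq _ _ _ P k (cst (- (9 / 50) * x)) _ Z _ mZ _ _) => //.
- rewrite -/B (_ : P B = \int[P]_w (\1_B w)%:E)%E; last first.
    by rewrite integral_indic// setIT.
  apply: ge0_le_integral => //.
  + exact/measurable_EFinP/measurable_indic.
  + apply/measurable_EFinP/measurableT_comp => //; apply: measurable_funD => //.
    apply: measurable_funM => //; apply: measurable_sum => a.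
    exact: measurable_funX.
  move=> w _; rewrite lee_fin indicE.
  case: (boolP (w \in B)) => [/set_mem wB|_]; last exact: expR_ge0.
  rewrite -[leLHS]expR0 ler_expR.
  have -> : \sum_(a < k) Z a w ^+ 2 = sigma ^- 2 * \sum_(a < k) dot (u a) (eps^~ w) ^+ 2.
    by rewrite mulr_sumr; apply: eq_bigr => a _; rewrite /Z exprMn exprVn.
  rewrite mulNr addrC subr_ge0 ler_pM2l//.
  by rewrite ler_pdivlMl ?exprn_gt0// mulrC ltW.
move=> h.
(* A linear form in the [Z a] is a linear form in the noise; orthogonality removes the cross terms
   of its variance. *)
pose v i := \sum_(a < k) (h a / sigma) * u a i.
have vE w : \sum_(a < k) h a * Z a w = dot v (eps^~ w).
  by rewrite dot_suml; apply: eq_bigr => a _; rewrite /Z mulrA.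
have vv : sigma ^+ 2 * dot v v = \sum_(a < k) h a ^+ 2 * dot (u a) (u a).
  rewrite {1}/v dot_suml mulr_sumr; apply: eq_bigr => a _.
  rewrite dotC dot_suml (bigD1 a)//= big1 ?addr0; last first.
    by move=> b ba; rewrite uo// mulr0.
  by field.
under eq_integral do rewrite vE /= expRD EFinM.
rewrite ge0_integralZl//.
- rewrite noise_mgf -EFinM lee_fin ler_wpM2l ?expR_ge0// ler_expR vv ler_pM2r//.
  by apply: ler_sum => a _; rewrite ler_piMr ?sqr_ge0.
- by apply/measurable_EFinP/measurableT_comp => //; exact: measurable_dot_noise.
Qed.
End GaussianNoise.

(** Expanding the product of the factors [1 + x] picks one subset per term; this sums the failure
    probabilities over all models. *)
Lemma sum_expr_cards (R : comNzRingType) (I : finType) (x : R) :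
  \sum_(A : {set I}) x ^+ #|A| = (1 + x) ^+ #|I|.
Proof.
rewrite -prodr_const addrC bigA_distr; apply: eq_bigr => A _.
by rewrite -big_mkcond prodr_const.
Qed.

(** * Union bound over the models *)

Section NoiseEvent.
Context (R : realType) (d : measure_display) (T : measurableType d).
Variables (P : probability T R) (n : nat) (eps : 'I_n -> T -> R) (sigma : R).
Hypotheses (sigma_gt0 : 0 < sigma) (Neps : gaussian_noise P eps sigma).

(** The noise enters only through its projection on the span of the columns [D A], whose norm is
    controlled for all [A] at once. The factor 2 in the bound on [D A] leaves room for the constant
    column, also when [A] is empty. *)
Lemma noise_event (I J : finType) (M : nat) (v : J -> 'I_n -> R)
    (D : {set I} -> {set J}) :
  (0 < #|I|)%N -> (0 < M)%N ->
  (forall A, #|D A| <= 2 * (M * maxn #|A| 1))%N ->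
  exists E : set T, [/\ measurable E,
    ((1 - 8 * (expR 1 * #|I|%:R) ^- (9 * M))%:E <= P E)%E &
    forall w, E w -> forall (A : {set I}) (b : J -> R) (g : 'I_n -> R),
      (forall i, g i = \sum_(c in D A) b c * v c i) ->
      2 * dot g (eps^~ w) <=
        240 * sigma ^+ 2 * M%:R * ln (expR 1 * #|I|%:R) * (maxn #|A| 1)%:R + dot g g / 4].
Proof.
move=> I0 M0 DM.
pose e1 : R := expR 1; pose m := #|I|; pose L := ln (e1 * m%:R).
have e2 : 2 <= e1 by have := expR_ge1Dx (1 : R); rewrite /e1; lra.
have m1 : 1 <= m%:R :> R by rewrite ler1n.
have em0 : 0 < e1 * m%:R by rewrite mulr_gt0 ?expR_gt0 ?ltr0n.
have L1 : 1 <= L.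
  rewrite -(expRK (1 : R)) ler_ln ?posrE ?expR_gt0//.
  by rewrite ler_pMr ?expR_gt0.
have expL N : expR (- (N%:R * L)) = (e1 * m%:R) ^- N.
  by rewrite expRN expRM_natl lnK.
have /choice[u Hu] (A : {set I}) := gram_schmidt _ v (enum (D A)).
pose k A := #|D A|.
pose a (A : {set I}) := maxn #|A| 1.
(* The tail exponent is 9/50 * 60 = 10.8 times [M * a A * L]. The dimension factor costs at most 0.5
   of it, because 5/4 is at most [expR (1 / 4)] and [L] is at least 1. The rest exceeds 10 times
   that product, hence [(9 * M + #|A|) * L]: the part [9 * M] gives the probability and [#|A|] makes
   the sum over models converge. *)
pose x A : R := 60 * (M * a A)%:R * L.
pose B A := [set w | (x A * sigma ^+ 2 < \sum_(j < k A) dot (u A j) (eps^~ w) ^+ 2)%R].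
have mB A : measurable (B A).
  rewrite /B -[X in measurable X]setTI.
  apply: (@measurable_fun_ltr _ _ _ _ (cst _)) => //.
  by apply: measurable_sum => j; apply: measurable_funX; apply: measurable_dot_noise Neps _.
have PB A : (P (B A) <= ((e1 * m%:R) ^- (9 * M) * (e1 * m%:R)^-1 ^+ #|A|)%:E)%E.
  have [uo u1 _ _] := Hu A.
  have ule1 j : dot (u A j) (u A j) <= 1.
    by have [->|->] := u1 j; rewrite ?dot0r ?ler01.
  apply: le_trans
    (noise_projection_tail _ _ _ _ _ _ _ sigma_gt0 Neps (k A) (u A) (x A) uo ule1) _.
  rewrite lee_fin exprVn -!expL -expRD.
  have le54 : 5 / 4 <= expR (1 / 4) :> R.
    by apply: le_trans (expR_ge1Dx _); lra.
  apply: (@le_trans _ _ (expR (- (9 / 50) * x A) * expR (1 / 4) ^+ k A)).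
    by rewrite ler_wpM2l ?expR_ge0// lerXn2r ?nnegrE ?expR_ge0//; lra.
  rewrite -expRM_natl -expRD ler_expR /x.
  have kA : (k A)%:R <= 2 * (M * a A)%:R :> R by rewrite -natrM ler_nat; exact: DM.
  have h1 : (9 * M)%:R + #|A|%:R <= 10 * (M * a A)%:R :> R.
    rewrite -!natrM -natrD ler_nat (mulnDl 9 1) mul1n leq_add//.
      by rewrite leq_mul2l leq_pmulr// leq_maxr.
    by rewrite (leq_trans (leq_maxl _ 1))// leq_pmull.
  have h2 : (M * a A)%:R <= (M * a A)%:R * L by rewrite ler_peMr.
  have h3 : ((9 * M)%:R + #|A|%:R) * L <= 10 * (M * a A)%:R * L.
    by rewrite ler_wpM2r//; lra.
  set X := (M * a A)%:R * L in h2 *.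
  rewrite -[10 * _ * L]mulrA -/X in h3.
  rewrite -[60 * _ * L]mulrA -/X.
  have : 0 <= (M * a A)%:R :> R by [].
  move: h3 kA h2; rewrite mulrDl; lra.
have fT : finite_set [set: {set I}] by exact: finite_finset.
exists (~` (\bigcup_(A in [set: {set I}]) B A)); split.
- by apply: measurableC; apply: fin_bigcup_measurable.
- rewrite probability_setC; last exact: fin_bigcup_measurable.
  rewrite EFinB leeB//.
  apply: le_trans (content_sub_fsum (D := [set: {set I}]) P fT _ _ (@subset_refl _ _)) _ => //.
    by apply: fin_bigcup_measurable.
  have -> : [set: {set I}] = [set` index_enum {set I}].
    by apply/seteqP; split=> A _ //=; exact: mem_index_enum.
  rewrite -fsbig_seq ?index_enum_uniq//=.
  apply: (@le_trans _ _ (\sum_(A : {set I})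
    ((e1 * m%:R) ^- (9 * M) * (e1 * m%:R)^-1 ^+ #|A|)%:E)%E).
    by apply: lee_sum => A _; exact: PB.
  rewrite sumEFin lee_fin -mulr_sumr sum_expr_cards mulrC.
  rewrite ler_wpM2r ?invr_ge0 ?exprn_ge0 ?(ltW em0)//.
  set y := (e1 * m%:R)^-1.
  apply: (@le_trans _ _ (expR y ^+ m)).
    rewrite lerXn2r ?nnegrE ?expR_ge0 ?expR_ge1Dx//.
    by rewrite addr_ge0// invr_ge0 ltW.
  rewrite -expRM_natl.
  have -> : m%:R * y = e1^-1.
    by rewrite mulrC /y invfM mulfVK// gt_eqF// ltr0n.
  (* Since [e1] is at least 2, [expR (- e1^-1)] is at least 1/2, so the sum over models is at most
     2, below the required 8. *)
  have := expR_ge1Dx (- e1^-1); rewrite expRN.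
  have ei : e1^-1 <= 1 / 2 by rewrite div1r lef_pV2 ?posrE ?expR_gt0//.
  move=> h; have : (1 / 2 : R) <= (expR e1^-1)^-1 by lra.
  rewrite div1r lef_pV2 ?posrE ?expR_gt0//; lra.
move=> w Ew A b g gE.
have [uo u1 _ uv] := Hu A.
have wB : \sum_(j < k A) dot (u A j) (eps^~ w) ^+ 2 <= x A * sigma ^+ 2.
  by rewrite leNgt; apply/negP => wB; apply: Ew; exists A.
have gu i : g i = \sum_(j < k A) dot g (u A j) * u A j i.
  have gF : g = fun i => \sum_(c in D A) b c * v c i by apply/funext.
  have -> : \sum_(j < k A) dot g (u A j) * u A j i =
      \sum_(j < k A) \sum_(c in D A) b c * dot (v c) (u A j) * u A j i.
    by apply: eq_bigr => j _; rewrite gF dot_suml mulr_suml.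
  rewrite exchange_big/= gE; apply: eq_bigr => c cD.
  rewrite (uv c) ?mem_enum// -cardE mulr_sumr.
  by apply: eq_bigr => j _; rewrite mulrA.
have gF : g = fun i => \sum_(j < k A) dot g (u A j) * u A j i by apply/funext.
rewrite {1 2}gF !dot_suml.
(* Coordinatewise, 2pz is at most 4z^2 + p^2/4; the factor 4 turns 60 into 240. *)
apply: (@le_trans _ _ (4 * (x A * sigma ^+ 2) + (\sum_(j < k A) dot g (u A j) ^+ 2) / 4)).
  apply: (@le_trans _ _ (4 * (\sum_(j < k A) dot (u A j) (eps^~ w) ^+ 2) +
    (\sum_(j < k A) dot g (u A j) ^+ 2) / 4)).
    rewrite !mulr_sumr mulr_suml -big_split/=; apply: ler_sum => j _.
    set p := dot g _; set z := dot _ _.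
    have := sqr_ge0 (2 * z - p / 2); lra.
  by rewrite lerD2r ler_pM2l.
rewrite lerD//.
  by rewrite /x natrM /L /e1 /m /a le_eqVlt; apply/orP; left; apply/eqP; ring.
rewrite le_eqVlt; apply/orP; left; apply/eqP; congr (_ / 4); apply: eq_bigr => j _.
by rewrite (dotC (u A j)) expr2.
Qed.
End NoiseEvent.

(** * The design matrix, counts of levels, and the deterministic inequality *)

Section Design.
Context (R : realType) (n q : nat) (p : 'I_q -> nat).
Variable Cat : 'I_n -> forall j : 'I_q, 'I_(p j).
Notation X := (@Xmul R n q p Cat).
Notation lvl := (Tagged (fun j => 'I_(p j))).

Lemma sum_colidx (V : nmodType) (A : {set 'I_q}) (F : colidx p -> V) :
  \sum_(c | tag c \in A) F c = \sum_(j in A) \sum_(k < p j) F (lvl k).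
Proof.
rewrite (sig_big_dep (fun j => j \in A) (fun _ _ => true) (fun j k => F (lvl k)))/=.
by apply: eq_big => -[j k] //=; rewrite andbT.
Qed.

Lemma card_tag_in (A : {set 'I_q}) :
  #|[set c : colidx p | tag c \in A]%SET| = (\sum_(j in A) p j)%N.
Proof.
rewrite -sum1dep_card sum_colidx; apply: eq_bigr => j _.
by rewrite sum1_card card_ord.
Qed.

Lemma card_colidx : #|{: colidx p}| = ptot p.
Proof.
transitivity #|[set c : colidx p | tag c \in [set: 'I_q]%SET]%SET|.
  by rewrite -cardsT; apply: eq_card => c; rewrite !inE.
by rewrite card_tag_in; apply: eq_bigl => j; rewrite inE.
Qed.

(** In each block, row [i] has a single entry 1, at the level [Cat i j]. *)
Lemma sum_Xdes (A : {set 'I_q}) (b : colidx p -> R) i :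
  \sum_(c | tag c \in A) Xdes R Cat i c * b c = \sum_(j in A) b (lvl (Cat i j)).
Proof.
rewrite sum_colidx; apply: eq_bigr => j _.
rewrite (bigD1 (Cat i j))//= /Xdes eqxx mul1r big1 ?addr0// => k kC.
by rewrite eq_sym (negbTE kC) mul0r.
Qed.

Lemma XmulE (b : colidx p -> R) i : X b i = \sum_j b (lvl (Cat i j)).
Proof.
rewrite /Xmul (eq_bigl (fun c => tag c \in [set: 'I_q]%SET)); last by move=> c; rewrite inE.
by rewrite sum_Xdes; apply: eq_bigl => j; rewrite inE.
Qed.

Lemma ndistinct_gt0 (b : colidx p -> R) j : (0 < p j)%N -> (0 < ndistinct b j)%N.
Proof.
move=> pj; rewrite /ndistinct lt0n size_eq0; apply/eqP => /undup_nil/(congr1 size).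
by rewrite /grpvals size_map size_enum_ord => /eqP; rewrite -leqn0 leqNgt pj.
Qed.

(** Filtering a list of distinct values loses at most the value 0. *)
Lemma ndistinct_le (b : colidx p -> R) j :
  (ndistinct b j <= (size (undup [seq x <- grpvals b j | x != 0%R])).+1)%N.
Proof.
rewrite -filter_undup size_filter /ndistinct -(count_predC (fun x : R => x != 0)) -addn1.
rewrite leq_add2l (@eq_count _ _ (pred1 0)) => [|x]; last by rewrite /= negbK.
by rewrite count_uniq_mem ?undup_uniq// leq_b1.
Qed.

Lemma sum_ndistinct_le (b : colidx p -> R) :
  (\sum_(j < q) ndistinct b j <= Kcount b + q)%N.
Proof.
rewrite -[q in (_ + q)%N]card_ord -sum1_card /Kcount -big_split/=.
by apply: leq_sum => j _; rewrite addn1 ndistinct_le.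
Qed.

Lemma l0E (b : colidx p -> R) : l0 b = #|[set c | b c != 0]%SET|.
Proof. by apply: eq_card => c; rewrite !inE; apply/asboolP/idP. Qed.

Definition varying (b : colidx p -> R) : {set 'I_q} := [set j | (1 < ndistinct b j)%N]%SET.

(** Of two distinct values at least one is nonzero. *)
Lemma card_varying_Kcount (b : colidx p -> R) : (#|varying b| <= Kcount b)%N.
Proof.
rewrite -sum1_card big_mkcond; apply: leq_sum => j _; rewrite inE.
by case: ifP => // /leq_trans/(_ (ndistinct_le b j)).
Qed.

(** Each predictor has at least one coefficient value, and a varying one at least two. The term [q]
    cancels the one in [sum_ndistinct_le] when the two penalties are compared. *)
Lemma card_varying_ndistinct (b : colidx p -> R) : (forall j, 0 < p j)%N ->
  (#|varying b| + q <= \sum_(j < q) ndistinct b j)%N.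
Proof.
move=> p0; rewrite -[q in (_ + q)%N]card_ord -!sum1_card big_mkcond -big_split/=.
apply: leq_sum => j _; rewrite inE addn1.
by case: ifP => // _; exact: ndistinct_gt0.
Qed.

Lemma not_varying_cst (b : colidx p -> R) j (k k' : 'I_(p j)) :
  j \notin varying b -> b (lvl k) = b (lvl k').
Proof.
rewrite inE -leqNgt /ndistinct => s1.
have in_s (l : 'I_(p j)) : b (lvl l) \in undup (grpvals b j).
  by rewrite mem_undup; apply: map_f; rewrite mem_enum.
move: (in_s k) (in_s k') s1; case: (undup _) => [//|x [|//]].
by rewrite !inE => /eqP -> /eqP ->.
Qed.

(* The constant column is indexed by [None]. *)
Definition design_col (c : option (colidx p)) (i : 'I_n) : R :=
  if c is Some c then Xdes R Cat i c else 1.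

(** The constant column is in every model: it carries the difference of intercepts and the
    contribution of the inactive predictors. *)
Definition modelcols (Q : pred (colidx p)) : {set option (colidx p)} :=
  (None |: [set Some c | c in [set c | Q c]])%SET.

Lemma card_modelcols (Q : pred (colidx p)) : (#|modelcols Q| <= #|[set c | Q c]%SET|.+1)%N.
Proof.
rewrite cardsU1 -add1n leq_add ?leq_b1//.
exact: leq_imset_card.
Qed.

Lemma sum_modelcols (Q : pred (colidx p)) (a : R) (b : colidx p -> R) i :
  \sum_(c in modelcols Q) (if c is Some c then b c else a) * design_col c i =
  a + \sum_(c | Q c) Xdes R Cat i c * b c.
Proof.
rewrite big_setU1/=; last by apply/imsetP => -[].
rewrite mulr1 big_imset/=; last by move=> ? ? _ _ [].
by congr (_ + _); apply: eq_big => c; rewrite ?inE// mulrC.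
Qed.

End Design.

(** Here [g] is the fit at the minimiser minus that at the competitor. Minimality bounds [sqnorm rh]
    by [sqnorm r + 2 * dot g e] plus [n] times the penalty difference. Since [dot g g / 4] is at
    most half of [sqnorm r + sqnorm rh], half of [sqnorm rh] moves to the left; doubling leaves 3 on
    the approximation error and 6 on the penalties. *)
Lemma oracle_inequality (R : realType) (n q : nat) (p : 'I_q -> nat)
    (Cat : 'I_n -> forall j : 'I_q, 'I_(p j)) (f e : 'I_n -> R) (lam lam0 N : R)
    (ah alpha : R) (bh beta : colidx p -> R) :
  is_global_minimiser Cat lam lam0 (fun i => f i + e i) ah bh ->
  let g i := ah - alpha + \sum_c Xdes R Cat i c * (bh c - beta c) in
  2 * dot g e <= N + dot g g / 4 ->
  lam0 * (l0 beta)%:R - lam0 * (l0 bh)%:R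
  + (lam * (\sum_(j < q) ndistinct beta j)%:R - lam * (\sum_(j < q) ndistinct bh j)%:R)
  + n%:R^-1 * N <= 3 * (lam0 * (maxn (l0 beta) 1)%:R + lam * (maxn (Kcount beta) 1)%:R) ->
  n%:R^-1 * sqnorm (fun i => f i - Xmul Cat bh i - ah) <= 6 * oracle Cat lam lam0 f alpha beta.
Proof.
move=> /(_ alpha beta) hmin g hg hpen.
pose rh i := f i - Xmul Cat bh i - ah; pose r i := f i - Xmul Cat beta i - alpha.
have gE i : g i = r i - rh i.
  rewrite /g /r /rh /Xmul; under eq_bigr do rewrite mulrBr.
  by rewrite sumrB; ring.
have e1 : sqnorm (fun i => f i + e i - ah - Xmul Cat bh i) =
    sqnorm rh + 2 * dot rh e + sqnorm e.
  rewrite /sqnorm /dot mulr_sumr -!big_split/=; apply: eq_bigr => i _.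
  by rewrite /rh; ring.
have e2 : sqnorm (fun i => f i + e i - alpha - Xmul Cat beta i) =
    sqnorm r + 2 * dot r e + sqnorm e.
  rewrite /sqnorm /dot mulr_sumr -!big_split/=; apply: eq_bigr => i _.
  by rewrite /r; ring.
have e3 : dot g e = dot r e - dot rh e.
  by rewrite -dotBl; apply: eq_bigr => i _; rewrite gE.
have e4 : dot g g <= 2 * sqnorm r + 2 * sqnorm rh.
  rewrite /sqnorm /dot !mulr_sumr -!big_split/=; apply: ler_sum => i _.
  by rewrite gE; have := sqr_ge0 (r i + rh i); lra.
move: hmin; rewrite /objective /oracle e1 e2 -/rh -/r.
have n0 : 0 <= n%:R^-1 :> R by rewrite invr_ge0.
have h5 : n%:R^-1 * (2 * dot g e) <= n%:R^-1 * (N + dot g g / 4) by rewrite ler_wpM2l.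
have h6 : n%:R^-1 * dot g g <= n%:R^-1 * (2 * sqnorm r + 2 * sqnorm rh) by rewrite ler_wpM2l.
rewrite e3 in h5.
have s0 : 0 <= n%:R^-1 * sqnorm r.
  by rewrite mulr_ge0// sumr_ge0// => i _; exact: sqr_ge0.
move: h5 h6 hpen s0; rewrite !mulrDr !mulrN.
rewrite !(mulrCA _ 2) [n%:R^-1 * (dot g g / 4)]mulrA.
lra.
Qed.

(** * The two penalty regimes *)

Theorem theorem2 (R : realType) :
  exists c_lam c_lam0 C : R, [/\ 0 < c_lam, 0 < c_lam0, 0 < C &
  forall (n q : nat) (p : 'I_q -> nat) (Cat : 'I_n -> forall j : 'I_q, 'I_(p j))
    (f : 'I_n -> R) (sigma lam lam0 : R)
    (d : measure_display) (T : measurableType d) (P : probability T R)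
    (eps : 'I_n -> T -> R),
    (0 < n)%N -> (0 < q)%N -> 0 < sigma ->
    gaussian_noise P eps sigma ->
    0 <= lam -> 0 <= lam0 ->
    (c_lam * sigma ^+ 2 * (pmax p)%:R * ln (expR 1 * q%:R) / n%:R <= lam
     \/ c_lam0 * sigma ^+ 2 * ln (expR 1 * (ptot p)%:R) / n%:R <= lam0) ->
    exists E : set T, [/\ measurable E,
      ((1 - 8 * (expR 1 * (ptot p)%:R) ^- 9
          - 8 * (expR 1 * q%:R) ^- (9 * pmax p)%N)%:E <= P E)%E &
      forall w, E w ->
        forall (ah : R) (bh : colidx p -> R),
          is_global_minimiser Cat lam lam0 (fun i => f i + eps i w) ah bh ->
          n%:R^-1 * sqnorm (fun i => f i - Xmul Cat bh i - ah)
          <= C * inf [set v | exists (alpha : R) (beta : colidx p -> R),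
                         v = oracle Cat lam lam0 f alpha beta]]].
Proof.
(* 240 is the noise constant of [noise_event], and 6 the factor of [oracle_inequality]. *)
exists 240, 240, 6; split=> // n q p Cat f sigma lam lam0 d T P eps.
move=> n0 q0 s0 Neps lam_ge0 lam0_ge0 hlam.
(* The levels of an existing observation show that every ['I_(p j)] is inhabited. *)
have p0 j : (0 < p j)%N by apply: leq_ltn_trans (leq0n _) (ltn_ord (Cat (Ordinal n0) j)).
have ptot_ge0 : 0 <= 8 * (expR 1 * (ptot p)%:R) ^- 9 :> R.
  by rewrite mulr_ge0// invr_ge0 exprn_ge0// mulr_ge0// expR_ge0.
have q_ge0 : 0 <= 8 * (expR 1 * q%:R) ^- (9 * pmax p) :> R.
  by rewrite mulr_ge0// invr_ge0 exprn_ge0// mulr_ge0// expR_ge0.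
have pmax_ge j : (p j <= pmax p)%N by exact: leq_bigmax.
have pmax0 : (0 < pmax p)%N := leq_trans (p0 (Ordinal q0)) (pmax_ge (Ordinal q0)).
(* The event is fixed before the competitor, so a bound against each competitor passes to the
   infimum. *)
suff [E [mE PE HE]] : exists E : set T, [/\ measurable E,
    ((1 - 8 * (expR 1 * (ptot p)%:R) ^- 9
          - 8 * (expR 1 * q%:R) ^- (9 * pmax p)%N)%:E <= P E)%E &
    forall w, E w -> forall (ah : R) (bh : colidx p -> R),
      is_global_minimiser Cat lam lam0 (fun i => f i + eps i w) ah bh ->
      forall alpha beta,
        n%:R^-1 * sqnorm (fun i => f i - Xmul Cat bh i - ah)
        <= 6 * oracle Cat lam lam0 f alpha beta].
  exists E; split=> // w Ew ah bh hmin.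
  rewrite -ler_pdivrMl//; apply: lb_le_inf.
    by exists (oracle Cat lam lam0 f 0 (fun=> 0)), 0, (fun=> 0).
  by move=> _ [alpha [beta ->]]; rewrite ler_pdivrMl//; exact: (HE w).
have nR : 0 < n%:R :> R by rewrite ltr0n.
have max1 k : 1 <= (maxn k 1)%:R :> R by rewrite ler1n leq_maxr.
have maxl k : k%:R <= (maxn k 1)%:R :> R by rewrite ler_nat leq_maxl.
have lamM k : lam * k%:R <= lam * (maxn k 1)%:R by rewrite ler_wpM2l.
have lam1 k : lam <= lam * (maxn k 1)%:R by rewrite ler_peMr.
have lam0M k : lam0 * k%:R <= lam0 * (maxn k 1)%:R by rewrite ler_wpM2l.
have lam01 k : lam0 <= lam0 * (maxn k 1)%:R by rewrite ler_peMr.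
case: hlam => [hl|hl].
- have [|//||E [mE PE HE]] :=
    noise_event _ _ _ P n eps sigma s0 Neps 'I_q _ (pmax p) (design_col R n q p Cat)
    (fun A => modelcols q p (fun c => tag c \in A)).
  + by rewrite card_ord.
  + move=> A; apply: leq_trans (card_modelcols _ _ _) _.
    rewrite card_tag_in mul2n -addnn -add1n leq_add//.
      by rewrite muln_gt0 pmax0 leq_maxr.
    apply: (@leq_trans (\sum_(j in A) pmax p)); first by apply: leq_sum.
    by rewrite sum_nat_const mulnC leq_mul2l leq_maxl orbT.
  exists E; split=> //.
    apply: le_trans PE; rewrite lee_fin card_ord; lra.
  move=> w Ew ah bh hmin alpha beta.
  pose A := (varying R q p bh :|: varying R q p beta)%SET.
  pose i0 := Ordinal n0.
  (* Outside [A] both coefficient vectors are constant on each block, so these contributions can be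
     read off at the observation [i0]. *)
  pose a := ah - alpha + \sum_(j in ~: A) (bh (Tagged (fun j => 'I_(p j)) (Cat i0 j))
      - beta (Tagged (fun j => 'I_(p j)) (Cat i0 j))).
  apply: (oracle_inequality _ _ _ _ Cat f (eps^~ w) lam lam0 _ ah alpha bh beta hmin).
    apply: (HE w Ew A (fun c => if c is Some c then bh c - beta c else a)) => i.
    rewrite sum_modelcols /a -[RHS]addrA; congr (_ + _).
    rewrite sum_Xdes -[LHS]/(Xmul Cat (fun c => bh c - beta c) i) XmulE.
    rewrite (bigID (fun j => j \in A))/= addrC; congr (_ + _).
    apply: eq_big => [j|j jA]; first by rewrite finset.in_setC.
    move: jA; rewrite finset.in_setU negb_or => /andP[bhj betaj].
    by congr (_ - _); exact: not_varying_cst.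
  (* The noise costs [lam * maxn #|A| 1]. Its share from the varying predictors of [bh] cancels
     against the penalty of [bh], and at most [2 * Kcount beta + 1] times [lam] is left, within
     three times the oracle penalty. *)
  have cA : (maxn #|A| 1)%:R <= #|varying R q p bh|%:R + (Kcount beta)%:R + 1 :> R.
    rewrite -natrD natr1 ler_nat geq_max /= andbT.
    apply: leqW; apply: (leq_trans (leq_card_setU _ _).1).
    by rewrite leq_add2l card_varying_Kcount.
  have K1 : (\sum_(j < q) ndistinct beta j)%:R <= (Kcount beta)%:R + q%:R :> R.
    by rewrite -natrD ler_nat sum_ndistinct_le.
  have K2 : #|varying R q p bh|%:R + q%:R <= (\sum_(j < q) ndistinct bh j)%:R :> R.
    by rewrite -natrD ler_nat card_varying_ndistinct.
  have hN : n%:R^-1 * (240 * sigma ^+ 2 * (pmax p)%:R * ln (expR 1 * #|'I_q|%:R)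
      * (maxn #|A| 1)%:R) <= lam * (maxn #|A| 1)%:R.
    by rewrite card_ord mulrA ler_wpM2r// mulrC.
  have hA := ler_wpM2l lam_ge0 cA; have hK1 := ler_wpM2l lam_ge0 K1.
  have hK2 := ler_wpM2l lam_ge0 K2; rewrite !mulrDr ?mulr1 in hA hK1 hK2.
  have h0 : 0 <= lam0 * (l0 bh)%:R by rewrite mulr_ge0.
  have := lamM (Kcount beta); have := lam1 (Kcount beta); have := lam0M (l0 beta).
  have := mulr_ge0 lam0_ge0 (le_trans ler01 (max1 (l0 beta))); lra.
have pt0 : (0 < ptot p)%N.
  by rewrite (leq_trans (p0 (Ordinal q0)))// /ptot (bigD1 (Ordinal q0))//= leq_addr.
have [|//||E [mE PE HE]] :=
    noise_event _ _ _ P n eps sigma s0 Neps (colidx p) _ 1 (design_col R n q p Cat)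
    (fun A => modelcols q p (fun c => c \in A)).
- by rewrite card_colidx.
- move=> A; apply: leq_trans (card_modelcols _ _ _) _.
  rewrite mul1n mul2n -addnn -add1n leq_add ?leq_maxr//.
  apply: leq_trans (leq_maxl _ _); rewrite leq_eqVlt; apply/orP; left.
  by apply/eqP/eq_card => c; rewrite inE.
exists E; split=> //.
  apply: le_trans PE; rewrite lee_fin card_colidx muln1; lra.
move=> w Ew ah bh hmin alpha beta.
pose A := ([set c | bh c != 0] :|: [set c | beta c != 0])%SET.
apply: (oracle_inequality _ _ _ _ Cat f (eps^~ w) lam lam0 _ ah alpha bh beta hmin).
  apply: (HE w Ew A (fun c => if c is Some c then bh c - beta c else ah - alpha)) => i.
  rewrite sum_modelcols; congr (_ + _).
  rewrite [RHS]big_mkcond; apply: eq_bigr => c _; case: ifPn => //.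
  by rewrite !inE negb_or !negbK => /andP[/eqP -> /eqP ->]; rewrite subrr mulr0.
(* Now [lam0 * l0 bh] cancels against the sparsity penalty of [bh], leaving [2 * l0 beta + 1] times
   [lam0]. The [lam] penalties differ by at most [lam * Kcount beta], as each predictor has at least
   one value under [bh]. *)
have cA : (maxn #|A| 1)%:R <= (l0 bh)%:R + (l0 beta)%:R + 1 :> R.
  rewrite -natrD natr1 ler_nat geq_max /= andbT.
  by apply: leqW; rewrite !l0E; exact: (leq_card_setU _ _).1.
have K1 : (\sum_(j < q) ndistinct beta j)%:R <= (Kcount beta)%:R + q%:R :> R.
  by rewrite -natrD ler_nat sum_ndistinct_le.
have K2 : q%:R <= (\sum_(j < q) ndistinct bh j)%:R :> R.
  by rewrite ler_nat (leq_trans (leq_addl #|varying R q p bh| _))// card_varying_ndistinct.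
have hN : n%:R^-1 * (240 * sigma ^+ 2 * 1 * ln (expR 1 * #|{: colidx p}|%:R)
    * (maxn #|A| 1)%:R) <= lam0 * (maxn #|A| 1)%:R.
  by rewrite card_colidx mulr1 mulrA ler_wpM2r// mulrC.
have hA := ler_wpM2l lam0_ge0 cA; have hK1 := ler_wpM2l lam_ge0 K1.
have hK2 := ler_wpM2l lam_ge0 K2; rewrite !mulrDr ?mulr1 in hA hK1 hK2.
have := lamM (Kcount beta); have := lam01 (l0 beta); have := lam0M (l0 beta).
have := mulr_ge0 lam_ge0 (le_trans ler01 (max1 (Kcount beta))); lra.
Qed.
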